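(* Let $\mathcal{D}_n := \frac{1}{n!}\sum_{\pi\in S_n}\langle\pi\rangle$ be the average stack-sorting depth over all permutations in $S_n$. Then the limit $\lim_{n\to\infty}\mathcal{D}_n/n$ exists (as a real number).
   Context: Permutations are written in one-line notation, as words in distinct integers; $S_n$ is the set of permutations of $\{1,\dots,n\}$. West's stack-sorting map $s$ takes a permutation (a finite word of distinct integers) $\pi$ to another arrangement $s(\pi)$ of the same letters, as follows. Start with an empty stack and an empty output word, and read $\pi$ from left to right. At each step, if there is a next unread entry of $\pi$ and either the stack is empty or the top element of the stack is greater than that next entry, push that next entry onto the stack; otherwise, pop the top element of the stack and append it to the right end of the output. The procedure ends when all entries have been appended to the output, and $s(\pi)$ is the output word. The stack-sorting depth $\langle\pi\rangle$ is the minimum integer $k\ge 0$ such that $s^k(\pi)$ (the $k$-fold iterate) is sorted, i.e. its entries are in increasing order. *)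

(* Defs.v *)
From mathcomp Require Import all_boot all_order all_fingroup all_algebra.
From mathcomp Require Import all_classical all_reals all_analysis.

Set Implicit Arguments.
Unset Strict Implicit.
Unset Printing Implicit Defensive.

(* Output still to be produced by the stack-sorting procedure when the stack
   is [stk], listed from the top down, and [inp] is the unread input. With no
   unread input the stack is popped entry by entry, i.e. output as listed. *)
Fixpoint stack_sort_from (inp stk : seq nat) {struct inp} : seq nat :=
  match inp with
  | [::] => stk
  | x :: inp' =>
    let fix pop_then_push (stk : seq nat) : seq nat :=
      match stk with
      | [::] => stack_sort_from inp' [:: x]
      | t :: stk' => if x < t then stack_sort_from inp' (x :: t :: stk')
                     else t :: pop_then_push stk'
      end
    in pop_then_push stk
  end.

Definition stack_sort (w : seq nat) : seq nat := stack_sort_from w [::].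

Lemma stack_sort_from_nil x inp :
  stack_sort_from (x :: inp) [::] = stack_sort_from inp [:: x].
Proof. by []. Qed.

Lemma stack_sort_from_cons x inp t stk :
  stack_sort_from (x :: inp) (t :: stk) =
    if x < t then stack_sort_from inp (x :: t :: stk)
    else t :: stack_sort_from (x :: inp) stk.
Proof. by []. Qed.

Lemma perm_stack_sort_from inp stk :
  perm_eq (stack_sort_from inp stk) (stk ++ inp).
Proof.
elim: inp stk => [|x inp IHi] stk; first by rewrite cats0.
elim: stk => [|t stk IHs]; first exact: IHi.
rewrite stack_sort_from_cons; case: ifP => _.
  by apply: perm_trans (IHi _) _; apply/permPl; exact: (perm_catCA [:: x] (t :: stk) inp).
by rewrite /= perm_cons.
Qed.

Lemma perm_stack_sort w : perm_eq (stack_sort w) w.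
Proof. exact: perm_stack_sort_from. Qed.

Lemma stack_sort_from_sorted v stk :
  sorted leq v -> allrel leq stk v -> stack_sort_from v stk = stk ++ v.
Proof.
elim: v stk => [|x v IHv] stk; first by rewrite cats0.
move=> xv; have sv := path_sorted xv.
elim: stk => [|t stk IHs]; last first.
  rewrite allrel_consl => /andP[/andP[tx _] /IHs].
  by rewrite stack_sort_from_cons ltnNge tx /= => ->.
move=> _; rewrite stack_sort_from_nil IHv //.
by rewrite allrel_consl allrel0l andbT (order_path_min leq_trans xv).
Qed.

Lemma stack_sort_from_cat u v stk :
    sorted leq v -> allrel leq (stk ++ u) v ->
  stack_sort_from (u ++ v) stk = stack_sort_from u stk ++ v.
Proof.
move=> sv; elim: u stk => [|x u IHu] stk.
  by rewrite cats0; exact: stack_sort_from_sorted.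
elim: stk => [|t stk IHs] uv; first exact: IHu.
rewrite cat_cons !stack_sort_from_cons; case: ifP => _; last first.
  by rewrite -cat_cons IHs //; move: uv; rewrite /= allrel_consl => /andP[].
apply: IHu; move: uv; rewrite /= !(allrel_consl, allrel_catl).
by case/and4P=> -> -> -> ->.
Qed.

Lemma stack_sort_from_last inp stk : sorted leq stk ->
  all (leq^~ (last 0 (stack_sort_from inp stk))) (stack_sort_from inp stk).
Proof.
elim: inp stk => [|x inp IHi] stk.
  case: stk => //= t stk; elim: stk t => [|y stk IHs] t /=.
    by rewrite leqnn.
  case/andP=> ty /IHs /= /andP[yl ->].
  by rewrite yl (leq_trans ty yl).
elim: stk => [|t stk IHs] st; first exact: IHi.
rewrite stack_sort_from_cons; case: ltnP => [xt|tx].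
  by apply: IHi => /=; rewrite ltnW.
have := perm_mem (perm_stack_sort_from (x :: inp) stk) x.
rewrite mem_cat mem_head orbT.
have := IHs (path_sorted st); case: (stack_sort_from _ _) => //= y s al xin.
rewrite al andbT; apply: leq_trans tx _.
by apply: (allP (al : all (leq^~ (last y s)) (y :: s))); rewrite xin.
Qed.

Lemma stack_sort_sorts (w : seq nat) :
  exists k, sorted leq (iter k stack_sort w).
Proof.
suff H n : forall u v, size u = n -> sorted leq v -> allrel leq u v ->
    exists k, sorted leq (iter k stack_sort (u ++ v)).
  by have := H _ w [::] erefl isT (allrel0r _ _); rewrite cats0.
elim: n => [|n IHn] u v su sv uv.
  by exists 0; rewrite (size0nil su).
have eu : stack_sort (u ++ v) = stack_sort u ++ v.
  exact: stack_sort_from_cat.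
have pu := perm_stack_sort u; have := perm_size pu; rewrite su => ss.
have := @stack_sort_from_last u [::] isT.
rewrite -/(stack_sort u); move: eu pu ss.
case/lastP: (stack_sort u) => // u' m eu pu; rewrite size_rcons => -[ss].
rewrite last_rcons all_rcons => /andP[_ al].
have : allrel leq (rcons u' m) v by rewrite (eq_allrel_meml _ _ (perm_mem pu)).
rewrite -cats1 allrel_catl allrel_consl allrel0l andbT => /andP[u'v mv].
have [||k sk] := IHn u' (m :: v) ss.
- by rewrite /= path_min_sorted.
- by rewrite allrel_consr al.
by exists k.+1; rewrite iterSr eu cat_rcons.
Qed.

(* The letters of a word of interest are distinct, so [sorted leq] means
   strictly increasing. *)
Definition stack_sorting_depth (w : seq nat) : nat :=
  ex_minn (stack_sort_sorts w).

(* The entries of ['S_n] are 0, ..., n - 1; words use the letters 1, ..., n. *)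
Definition one_line (n : nat) (p : 'S_n) : seq nat :=
  [seq (p i : nat).+1 | i <- enum 'I_n].

Local Open Scope ring_scope.

Definition average_depth (R : realType) (n : nat) : R :=
  (\sum_(p : 'S_n) (stack_sorting_depth (one_line p))%:R) / n`!%:R.

(* Main.v *)
Require Import Defs.
From mathcomp Require Import all_boot all_order all_fingroup all_algebra.
From mathcomp Require Import all_classical all_reals all_analysis.
From mathcomp Require Import zify ring lra.
Import numFieldNormedType.Exports.

(** Build a permutation by inserting its letters in decreasing order.  A letter
smaller than all the others is popped as soon as the next letter is read, so it
does not disturb them under the stack-sorting map; only its position moves.
Hence each gap between letters of a word [w] has a well-defined image gap in
the sorted word ([gap_map]), these maps are monotone, and once the images of
two gaps coincide they stay together.  A new smallest letter inserted at gap
[g] reaches the front exactly when gap [g] has merged with gap [0].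

Record, for each letter of [w], the time at which the gaps on its two sides
merge.  This profile [d] evolves by a rule that no longer mentions stacks
([coalescence_profile_insert]): inserting a new smallest letter at gap [g] puts
a [1] there and increments the strict left-to-right records of the part of [d]
to its right.  The depth of the new word is the maximum of the old depth and of
the entries of [d] to the left of [g] ([depth_insert]).  The question is thus
about a random growth process: insert at a uniformly random gap, [n] times.

Let [U] be the maximum of [d], [l] the number of gaps to the left of its first
occurrence and [r] the number to the left of its last one.  An insertion
increases [U], by one, exactly when it happens at one of these [r] gaps, so
E U(n+1) - E U(n) = E r / (n+1).  On the other hand [l / (n+1)] is a
submartingale: insertions at the first [l] gaps increase [l] by one, as in
Polya's urn, insertions at the last ones do not change it, and an insertion
between the first and the last occurrence of the maximum moves the first
occurrence to the right, beyond the insertion point.  So E l / (n+1) is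
nondecreasing and bounded, hence converges, and its increments dominate
(E (r - l) / (n+1))^2 / 4 ([mean_first_succ]).  Therefore E r / (n+1) has the
same limit, and so has E U(n) / n by Cesaro's lemma ([mean_max_cvg]).

It remains to see that the depth, which is at most [U], is on average not much
smaller ([mean_depth_ge]).  Compare the word with its [m] smallest letters to
the word of its [N] other letters.  The depth is at least the maximum of the
profile of the latter restricted to the left of the rightmost small letter.
Only [N / (m+1)] of the [N] letters are on average to the right of it, and a
prefix of a random profile is distributed as a shorter random profile
([mean_prefix]); dropping [b] letters costs at most [b] in the mean of [U]. *)

Set Implicit Arguments.
Unset Strict Implicit.
Unset Printing Implicit Defensive.

(** * Gaps of a word under the stack-sorting map *)

Fixpoint stack_output (inp stk : seq nat) : seq nat :=
  if inp is x :: inp' then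
    let k := find (ltn x) stk in take k stk ++ stack_output inp' (x :: drop k stk)
  else [::].

Fixpoint stack_left (inp stk : seq nat) : seq nat :=
  if inp is x :: inp' then stack_left inp' (x :: drop (find (ltn x) stk) stk)
  else stk.

Lemma stack_output_cat u v stk :
  stack_output (u ++ v) stk =
    stack_output u stk ++ stack_output v (stack_left u stk).
Proof. by elim: u stk => //= x u IHu stk; rewrite IHu catA. Qed.

Lemma stack_sort_from_step x inp stk :
  stack_sort_from (x :: inp) stk =
    take (find (ltn x) stk) stk ++
      stack_sort_from inp (x :: drop (find (ltn x) stk) stk).
Proof.
elim: stk => [|t stk IHs] //.
by rewrite stack_sort_from_cons [find _ _]/=; case: ltnP => // _; rewrite IHs.
Qed.

Lemma stack_sort_from_split u v stk :
  stack_sort_from (u ++ v) stk =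
    stack_output u stk ++ stack_sort_from v (stack_left u stk).
Proof.
elim: u stk => //= x u IHu stk.
by rewrite -catA -IHu -stack_sort_from_step.
Qed.

Lemma stack_left_subset u stk : {subset stack_left u stk <= stk ++ u}.
Proof.
elim: u stk => [|x u IHu] stk y /=; first by rewrite cats0.
move/IHu; rewrite /= !(inE, mem_cat) => /or3P[->|/mem_drop->|->] //;
  by rewrite ?orbT.
Qed.

Definition insert (g a : nat) (w : seq nat) := take g w ++ a :: drop g w.

Lemma size_insert g a w : size (insert g a w) = (size w).+1.
Proof. by rewrite size_cat /= addnS -size_cat cat_take_drop. Qed.

Lemma perm_insert g a w : perm_eq (insert g a w) (a :: w).
Proof. by rewrite /insert perm_catC /= perm_cons perm_catC cat_take_drop. Qed.

(** When the first [g] letters have been read, whatever has been output is final;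
the image of gap [g] is right after that output, which is where a letter
smaller than all the others and sitting at gap [g] goes. *)
Definition gap_map (w : seq nat) (g : nat) := size (stack_output (take g w) [::]).

Lemma gap_map0 w : gap_map w 0 = 0.
Proof. by rewrite /gap_map take0. Qed.

Lemma leq_gap_map w g h : g <= h -> gap_map w g <= gap_map w h.
Proof.
move=> gh; rewrite /gap_map -(subnKC gh) takeD stack_output_cat size_cat.
exact: leq_addr.
Qed.

Lemma size_stack_sort w : size (stack_sort w) = size w.
Proof. exact: perm_size (perm_stack_sort w). Qed.

Lemma gap_map_size w g : gap_map w g <= size w.
Proof.
rewrite -[in leqRHS](size_stack_sort w) -[in leqRHS](cat_take_drop g w).
by rewrite /stack_sort stack_sort_from_split size_cat leq_addr.
Qed.

Lemma find_ltn_min a s : all (ltn a) s -> find (ltn a) s = 0.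
Proof. by case: s => //= b s /andP[->]. Qed.

Lemma stack_left_min a g w :
  all (ltn a) w -> all (ltn a) (stack_left (take g w) [::]).
Proof. by move=> /allP aw; apply/allP => x /stack_left_subset /mem_take /aw. Qed.

Lemma stack_sort_insert g a w : all (ltn a) w ->
  stack_sort (insert g a w) = insert (gap_map w g) a (stack_sort w).
Proof.
move=> aw; set u := take g w; set k := stack_left u [::].
have ww : stack_sort w = stack_output u [::] ++ stack_sort_from (drop g w) k.
  by rewrite -stack_sort_from_split cat_take_drop.
rewrite ww /insert /gap_map take_size_cat // drop_size_cat //.
rewrite /stack_sort stack_sort_from_split -/k stack_sort_from_step.
rewrite find_ltn_min ?stack_left_min // take0 drop0 /=; congr (_ ++ _).
have : all (ltn a) (drop g w) by apply/allP => x /mem_drop; apply/allP.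
by case: (drop g w) => //= x v /andP[ax _]; rewrite ltnNge (ltnW ax).
Qed.

(** The new letter [a] counts in the output only from the second letter after it
on, because the first letter after it pops it.  So the gap [g.+1] just after
[a] jumps to the left of [a]: it does not keep its place relative to [a]. *)
Lemma gap_map_insert g a w j : all (ltn a) w -> g <= size w ->
    j <= (size w).+1 ->
  gap_map (insert g a w) j = gap_map w (j - (g < j)) + (g.+1 < j).
Proof.
move=> aw gw jw; rewrite /gap_map /insert.
have sg : size (take g w) = g by rewrite size_takel.
have kw := stack_left_min g aw.
case: (ltngtP g j) => [gj|jg|<-]; last 2 first.
- rewrite subn0 take_cat sg jg ltnNge (leqW (ltnW jg)) addn0 /=.
  by rewrite take_takel // ltnW.
- by rewrite subn0 take_cat sg ltnn subnn take0 cats0 ltnNge leqnSn addn0.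
rewrite take_cat sg ltnNge (ltnW gj) /= stack_output_cat size_cat subn1.
case: j gj jw => // j gj jw; rewrite subSn //= ltnS.
rewrite find_ltn_min // take0 drop0 /=.
have -> : take j w = take g w ++ take (j - g) (drop g w).
  by rewrite -takeD subnKC // -ltnS.
rewrite stack_output_cat size_cat; case: ltnP => jg; last first.
  by rewrite (eqP (_ : j - g == 0)) ?subn_eq0 // take0 /= !addn0.
case E: (take (j - g) (drop g w)) => [|x v].
  by move/(congr1 size): E; rewrite size_take_min size_drop /=; lia.
have /= ax : a < x.
  have : x \in take (j - g) (drop g w) by rewrite E mem_head.
  by move/mem_take/mem_drop/(allP aw).
by rewrite /= ltnNge (ltnW ax) /= addn1 addnS.
Qed.

Fixpoint gap_iter (t : nat) (w : seq nat) (g : nat) :=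
  if t is t'.+1 then gap_map (iter t' stack_sort w) (gap_iter t' w g) else g.

Lemma perm_iter_stack_sort t w : perm_eq (iter t stack_sort w) w.
Proof.
by elim: t => //= t IHt; apply: perm_trans IHt; exact: perm_stack_sort.
Qed.

Lemma leq_gap_iter t w g h : g <= h -> gap_iter t w g <= gap_iter t w h.
Proof. by elim: t => //= t IHt /IHt; exact: leq_gap_map. Qed.

Lemma gap_iter0 t w : gap_iter t w 0 = 0.
Proof. by elim: t => //= t ->; exact: gap_map0. Qed.

Lemma gap_iter_size t w g : g <= size w -> gap_iter t w g <= size w.
Proof.
case: t => //= t _.
by rewrite -(perm_size (perm_iter_stack_sort t w)) gap_map_size.
Qed.

Lemma iter_stack_sort_insert t g a w : all (ltn a) w ->
  iter t stack_sort (insert g a w) =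
    insert (gap_iter t w g) a (iter t stack_sort w).
Proof.
move=> aw; elim: t => //= t ->; apply: stack_sort_insert.
by rewrite (perm_all _ (perm_iter_stack_sort t w)).
Qed.

(** Gap [j] of the longer word projects to gap [i] of [w], and its iterates
project to those of [i].  The only other information is whether the iterate is
to the right of [a]; by [gap_map_insert] this holds after [t.+1] steps iff the
iterates of the gaps [i] and [g] of [w] were still apart after [t] steps. *)
Lemma gap_iter_insert t g a w j (i := j - (g < j)) :
    all (ltn a) w -> g <= size w -> j <= (size w).+1 ->
  gap_iter t.+1 (insert g a w) j =
    gap_iter t.+1 w i + (gap_iter t w g < gap_iter t w i).
Proof.
move=> aw gw jw; elim: t => [|t IHt].
  rewrite /= gap_map_insert // -/i; congr (_ + nat_of_bool _).
  by rewrite /i; case: (ltnP g j); lia.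
have iw : i <= size w by rewrite /i; case: (ltnP g j); lia.
set G := gap_iter t.+1 w g; set I := gap_iter t.+1 w i in IHt *.
have W := perm_iter_stack_sort t.+1 w.
rewrite [LHS]/= -/(iter t.+1 _ _) -/(gap_iter t.+1 _ _) iter_stack_sort_insert //.
rewrite IHt -/G gap_map_insert; first last.
- rewrite (perm_size W).
  have : I <= size w by exact: gap_iter_size.
  by case: (_ < _) => /=; lia.
- by rewrite (perm_size W); exact: gap_iter_size.
- by rewrite (perm_all _ W).
case: ltnP => h.
  have GI : G <= I by exact: leq_gap_map (ltnW h).
  by rewrite addn1 ltnS GI subn1 /= ltnS.
have IG : I <= G by exact: leq_gap_map h.
by rewrite addn0 ltnNge IG subn0 ltnNge (leqW IG).
Qed.

(** * The profile of coalescence times *)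

(** [m] is the maximum of the entries already passed; with [m = 0] the first entry
of a profile, which is positive, is a record. *)
Fixpoint raise_records (m : nat) (d : seq nat) : seq nat :=
  if d is x :: d' then x + (m < x) :: raise_records (maxn m x) d' else [::].

Definition insert_profile (g : nat) (d : seq nat) :=
  take g d ++ 1 :: raise_records 0 (drop g d).

Lemma size_raise_records m d : size (raise_records m d) = size d.
Proof. by elim: d m => //= x d IHd m; rewrite IHd. Qed.

Lemma size_insert_profile g d : size (insert_profile g d) = (size d).+1.
Proof. by rewrite size_cat /= size_raise_records addnS -size_cat cat_take_drop. Qed.

Lemma nth_raise_records m d k : k < size d ->
  nth 0 (raise_records m d) k =
    nth 0 d k + all (fun y => y < nth 0 d k) (m :: take k d).
Proof.
elim: d m k => // x d IHd m [_|k] /=; first by rewrite andbT.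
by rewrite ltnS => /(IHd (maxn m x)) ->; rewrite /= gtn_max andbA.
Qed.

(** Gaps that have merged stay merged, so one number per letter, the merging time
of the gaps on its two sides, determines when any two gaps merge. *)
Definition coalescence_profile (w d : seq nat) := size d = size w /\
  forall t i, i < size w ->
    (gap_iter t w i == gap_iter t w i.+1) = (nth 0 d i <= t).

Lemma gap_iter_eq w d t i j : coalescence_profile w d -> i <= j <= size w ->
  (gap_iter t w i == gap_iter t w j) = all (leq^~ t) (take (j - i) (drop i d)).
Proof.
move=> [sd wd] /andP[ij]; rewrite -(subnKC ij) addKn.
elim: (j - i) => [_|k IHk]; first by rewrite addn0 eqxx take0.
rewrite addnS => ik; rewrite (take_nth 0) ?size_drop; last by lia.
rewrite all_rcons nth_drop -wd // -IHk ?(ltnW ik) //.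
have := leq_gap_iter t w (leq_addr k i).
have := leq_gap_iter t w (leqnSn (i + k)).
by lia.
Qed.

Lemma coalescence_profile_gt0 w d : coalescence_profile w d -> all (ltn 0) d.
Proof.
case=> sd wd; apply/(all_nthP 0) => i; rewrite sd => iw.
by have := wd 0 i iw; rewrite /= eqn_leq ltnn andbF ltnNge => <-.
Qed.

(** Only a letter to the right of [a] can be affected.  Let [x] be its merging
time.  If the gap on its left meets the gap of [a] before time [x], it jumps to
the left of [a] one step later while the gap on its right is still to the right
of [a]; at time [x] the letter [a] separates the two gaps, and they merge one
step later.  Otherwise they are on the same side of [a] and merge at time [x].
The condition says that all entries between [a] and the letter are smaller than
[x], i.e. that [x] is a record of the part of [d] to the right of [a]. *)
Lemma coalescence_profile_insert g a w d :
    all (ltn a) w -> g <= size w -> coalescence_profile w d ->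
  coalescence_profile (insert g a w) (insert_profile g d).
Proof.
move=> aw gw cw; have [sd wd] := cw.
split; first by rewrite size_insert size_insert_profile sd.
move=> t j; rewrite size_insert => jw.
have sg : size (take g d) = g by rewrite size_takel ?sd.
have d0 i : i < size w -> 0 < nth 0 d i.
  by rewrite -sd; exact: (all_nthP 0 (coalescence_profile_gt0 cw)).
rewrite /insert_profile nth_cat sg.
have [jg|gj] := ltnP j g.
  rewrite nth_take // -wd; last by lia.
  case: t => [|t]; first by [].
  rewrite !gap_iter_insert //; last by lia.
  have h1 := leq_gap_iter t w (ltnW jg); have h2 := leq_gap_iter t w jg.
  by rewrite (ltnNge _ j) (ltnNge _ j.+1) (ltnW jg) jg !subn0 !ltnNge h1 h2 !addn0.
case E: (j - g) => [|k].
  have -> : j = g by lia.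
  case: t => [|t]; first by rewrite /= eqn_leq ltnn andbF.
  by rewrite !gap_iter_insert ?ltnn ?ltnSn ?subn0 ?subn1 ?eqxx //; lia.
have {E gj} jk : j = (g + k).+1 by lia.
rewrite {j}jk in jw *; have gk : g + k < size w by [].
rewrite /= nth_raise_records ?size_drop ?nth_drop; last by lia.
have x0 := d0 _ gk; rewrite /= x0 /=.
case: t => [|t]; first by rewrite /= eqn_leq ltnn andbF; lia.
rewrite !gap_iter_insert //; last by lia.
have -> : g < (g + k).+1 by lia.
have -> : g < (g + k).+2 by lia.
(* The letter at index [g + k] of [w] is to the right of [a]. *)
rewrite !subn1 !succnK.
have e0 := wd t.+1 _ gk.
have gk0 : g <= g + k <= size w by lia.
have gk1 : g <= (g + k).+1 <= size w by lia.
have e1 := gap_iter_eq t cw gk0; have e2 := gap_iter_eq t cw gk1.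
rewrite addKn in e1; rewrite -addnS addKn in e2.
rewrite (take_nth 0) ?size_drop ?all_rcons ?nth_drop in e2; last by lia.
rewrite addnS in e2.
set x := nth 0 d (g + k) in x0 e0 e2 *.
have xt : (x == t.+1) ==> (all (fun y => y < x) (take k (drop g d)) ==
    all (leq^~ t) (take k (drop g d))) by apply/implyP => /eqP ->.
have m0 := leq_gap_iter t.+1 w (leqnSn (g + k)).
have m1 := leq_gap_iter t w (leqnSn (g + k)).
have m2 := leq_gap_iter t w (leq_addr k g).
by lia.
Qed.

(** * Stack-sorting depth in terms of the profile *)

Lemma stack_sorting_depth_le w t :
  (stack_sorting_depth w <= t) = sorted leq (iter t stack_sort w).
Proof.
rewrite /stack_sorting_depth; case: ex_minnP => m sm mmin.
apply/idP/idP => [mt|/mmin //]; rewrite -(subnK mt) iterD.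
elim: (t - m) => //= k sk.
by rewrite /stack_sort stack_sort_from_sorted.
Qed.

Lemma sorted_insert g a w : all (ltn a) w -> g <= size w ->
  sorted leq (insert g a w) = sorted leq w && (g == 0).
Proof.
case: g => [|g] aw gw.
  rewrite /insert take0 drop0 /= andbT path_min_sorted //.
  by apply: sub_all aw => x /ltnW.
rewrite andbF; case: w aw gw => //= x w /andP[ax aw] gw.
apply/negbTE/negP => /(order_path_min leq_trans).
by rewrite all_cat /= (leqNgt x a) ax andbF.
Qed.

Definition maxs (d : seq nat) : nat := \max_(x <- d) x.

Lemma maxs_cons x d : maxs (x :: d) = maxn x (maxs d).
Proof. exact: big_cons. Qed.

Lemma maxs_cat d e : maxs (d ++ e) = maxn (maxs d) (maxs e).
Proof. exact: big_cat. Qed.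

Lemma maxs_le d t : (maxs d <= t) = all (leq^~ t) d.
Proof.
by elim: d => [|x d IHd]; rewrite ?maxs_cons ?geq_max /= ?IHd // /maxs big_nil.
Qed.

(** The iterates of the longer word are those of [w] with [a] inserted, so they
are sorted once those of [w] are and the gap of [a] has merged with gap [0]. *)
Lemma depth_insert g a w d :
    all (ltn a) w -> g <= size w -> coalescence_profile w d ->
  stack_sorting_depth (insert g a w) =
    maxn (stack_sorting_depth w) (maxs (take g d)).
Proof.
move=> aw gw cw.
suff le t : (stack_sorting_depth (insert g a w) <= t) =
    (maxn (stack_sorting_depth w) (maxs (take g d)) <= t).
  by apply/eqP; rewrite eqn_leq -le leqnn le leqnn.
rewrite geq_max !stack_sorting_depth_le maxs_le iter_stack_sort_insert //.
have W := perm_iter_stack_sort t w.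
rewrite sorted_insert ?(perm_all _ W) ?(perm_size W) ?gap_iter_size //.
have := @gap_iter_eq w d t 0 g cw gw.
by rewrite gap_iter0 subn0 drop0 eq_sym => ->.
Qed.

(** * Insertion codes of permutations *)

(** A code lists the gaps of the successive insertions, the most recent first. *)
Fixpoint codes (n : nat) : seq (seq nat) :=
  if n is m.+1 then [seq g :: c | c <- codes m, g <- iota 0 n] else [:: [::]].

(** The letters are inserted in the order [n, n - 1, ...]. *)
Fixpoint word (n : nat) (c : seq nat) : seq nat :=
  if c is g :: c' then insert g (n - size c') (word n c') else [::].

Fixpoint profile (c : seq nat) : seq nat :=
  if c is g :: c' then insert_profile g (profile c') else [::].

Fixpoint code_depth (c : seq nat) : nat :=
  if c is g :: c' then maxn (code_depth c') (maxs (take g (profile c'))) else 0.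

Lemma codesS n :
  codes n.+1 = [seq g :: c | c <- codes n, g <- iota 0 n.+1].
Proof. by []. Qed.

Lemma codesP n g c :
  (g :: c \in codes n.+1) = (c \in codes n) && (g <= n).
Proof.
apply/allpairsPdep/andP => [[c' [g' [c'n]]]|[cn gn]].
  by rewrite mem_iota => gn [-> ->].
by exists c, g; rewrite mem_iota.
Qed.

Lemma codes_consP n c : c \in codes n.+1 ->
  exists g c', [/\ c = g :: c', c' \in codes n & g <= n].
Proof.
case/allpairsPdep => c' [g [c'n]]; rewrite mem_iota => gn ->.
by exists g, c'.
Qed.

Lemma size_codes n : size (codes n) = n`!.
Proof. by elim: n => // n IHn; rewrite codesS size_allpairs size_iota IHn mulnC. Qed.

Lemma size_code n c : c \in codes n -> size c = n.
Proof.
elim: n c => [|n IHn] c; first by rewrite inE => /eqP ->.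
by case/codes_consP => g [c' [-> /IHn /= ->]].
Qed.

Lemma size_profile c : size (profile c) = size c.
Proof. by elim: c => //= g c IHc; rewrite size_insert_profile IHc. Qed.

Lemma perm_word n k c : k <= n -> c \in codes k ->
  perm_eq (word n c) (iota (n - k).+1 k).
Proof.
elim: k c => [|k IHk] c kn; first by rewrite inE => /eqP ->.
case/codes_consP => g [c' [-> c'k gk]] /=.
apply: perm_trans (perm_insert _ _ _) _; rewrite (size_code c'k) /=.
by rewrite subnSK // perm_cons IHk // ltnW.
Qed.

Lemma word_gt n k c : k < n -> c \in codes k -> all (ltn (n - k)) (word n c).
Proof.
move=> kn ck; rewrite (perm_all _ (perm_word (ltnW kn) ck)).
by apply/allP => x; rewrite mem_iota => /andP[].
Qed.

Lemma coalescence_profile_word n k c : k <= n -> c \in codes k ->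
  coalescence_profile (word n c) (profile c).
Proof.
elim: k c => [|k IHk] c kn; first by rewrite inE => /eqP ->.
case/codes_consP => g [c' [-> c'k gk]] /=.
rewrite (size_code c'k); apply: coalescence_profile_insert.
- exact: word_gt.
- by rewrite (perm_size (perm_word (ltnW kn) c'k)) size_iota.
- exact: IHk (ltnW kn) c'k.
Qed.

Lemma depth_word n k c : k <= n -> c \in codes k ->
  stack_sorting_depth (word n c) = code_depth c.
Proof.
elim: k c => [|k IHk] c kn.
  by rewrite inE => /eqP -> /=; apply/eqP; rewrite -leqn0 stack_sorting_depth_le.
case/codes_consP => g [c' [-> c'k gk]] /=.
rewrite (size_code c'k) (depth_insert (d := profile c')) ?(IHk c') ?(ltnW kn) //.
- exact: word_gt.
- by rewrite (perm_size (perm_word (ltnW kn) c'k)) size_iota.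
- exact: coalescence_profile_word (ltnW kn) c'k.
Qed.

(** Delete the smallest letter and remember where it was. *)
Lemma word_onto n k w : k <= n -> perm_eq w (iota (n - k).+1 k) ->
  w \in [seq word n c | c <- codes k].
Proof.
elim: k w => [|k IHk] w kn; first by move/perm_nilP ->.
rewrite /= subnSK // => pw; set a := n - k in pw.
have aw : a \in w by rewrite (perm_mem pw) mem_head.
have /perm_to_rem pa := aw.
have : rem a w \in [seq word n c | c <- codes k].
  apply: IHk (ltnW kn) _; rewrite -(perm_cons a).
  by rewrite -(permPl pa).
case/mapP => c ck wc; apply/mapP; exists (index a w :: c).
  rewrite codesP ck -ltnS; apply: leq_trans (_ : size w <= _).
    by rewrite index_mem.
  by rewrite (perm_size pw) /= size_iota.
rewrite /= (size_code ck) -wc -/a /insert remE.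
rewrite take_size_cat ?drop_size_cat ?size_takel ?index_size //.
by rewrite -drop_index // cat_take_drop.
Qed.

Lemma one_line_inj n : injective (@one_line n).
Proof.
move=> p q /eq_in_map pq; apply/permP => i; apply/val_inj.
by have [] := pq i (mem_enum _ i).
Qed.

Lemma perm_one_line n (p : 'S_n) : perm_eq (one_line p) (iota 1 n).
Proof.
apply: uniq_perm; rewrite ?iota_uniq //.
  rewrite map_inj_uniq ?enum_uniq // => i j [/val_inj]; exact: perm_inj.
move=> x; apply/mapP/idP => [[i _ ->]|].
  by rewrite mem_iota add1n /= ltnS ltn_ord.
rewrite mem_iota add1n; case: x => // x /= xn.
by exists ((p^-1)%g (Ordinal (xn : x < n))); rewrite ?mem_enum // permKV.
Qed.

Lemma perm_one_line_word n :
  perm_eq [seq one_line p | p : 'S_n] [seq word n c | c <- codes n].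
Proof.
have u1 : uniq [seq one_line p | p : 'S_n].
  by rewrite map_inj_uniq ?enum_uniq //; exact: one_line_inj.
have s12 : {subset [seq one_line p | p : 'S_n] <= [seq word n c | c <- codes n]}.
  move=> w /mapP[p _ ->]; apply: word_onto => //.
  by rewrite subnn perm_one_line.
have s : size [seq word n c | c <- codes n] <= size [seq one_line p | p : 'S_n].
  by rewrite size_map size_codes size_image -card_Sn.
have [e2 e1] := uniq_min_size u1 s12 s.
by apply: uniq_perm; rewrite // -(eq_uniq e2 e1).
Qed.

(** * First and last maximum of a profile *)

Lemma maxs_nil : maxs [::] = 0.
Proof. exact: big_nil. Qed.

Lemma maxs_mem d : 0 < size d -> maxs d \in d.
Proof.
elim: d => // x [|y d] IHd _; first by rewrite maxs_cons maxs_nil maxn0 mem_head.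
rewrite maxs_cons in_cons; case: leqP => _; rewrite ?eqxx // IHd ?orbT //.
Qed.

Lemma leq_maxs x d : x \in d -> x <= maxs d.
Proof. by move=> xd; have := leqnn (maxs d); rewrite maxs_le => /allP; exact. Qed.

(** The first occurrence of the maximum is a record, its other occurrences are
not, and the entries below the maximum grow at most up to it. *)
Lemma maxs_raise_records m d :
  maxs (raise_records m d) = maxs d + (m < maxs d).
Proof.
elim: d m => [|x d IHd] m; first by rewrite maxs_nil ltn0.
by rewrite /= !maxs_cons IHd; lia.
Qed.

Lemma index_raise_records m d : m < maxs d ->
  index (maxs d).+1 (raise_records m d) = index (maxs d) d.
Proof.
elim: d m => [|x d IHd] m; first by rewrite maxs_nil.
rewrite maxs_cons /=; have [dx|xd] := leqP (maxs d) x.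
  by move=> mx; rewrite mx addn1 !eqxx.
move=> md; rewrite ifF ?IHd ?gtn_max ?md ?xd ?ifF //; lia.
Qed.

Fixpoint last_gap (x : nat) (d : seq nat) : nat :=
  if d is _ :: d' then if x \in d then (last_gap x d').+1 else 0 else 0.

Lemma mem_drop_last_gap x d g : (x \in drop g d) = (g < last_gap x d).
Proof.
elim: d g => // y d IHd [|g]; first by rewrite drop0 /=; case: ifP.
rewrite [drop _ _]/= IHd [last_gap _ (_ :: _)]/=; case: ifPn => //.
rewrite in_cons negb_or => /andP[_].
by rewrite -[d in x \notin d]drop0 IHd ltn0; lia.
Qed.

Lemma last_gap_size x d : last_gap x d <= size d.
Proof. by elim: d => //= y d IHd; case: ifP. Qed.

(** Both count gaps rather than letters: an entry of index [i] has [i.+1] gaps on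
its left. *)
Definition first_max (d : seq nat) := (index (maxs d) d).+1.
Definition last_max (d : seq nat) := last_gap (maxs d) d.

Lemma last_max_size d : last_max d <= size d.
Proof. exact: last_gap_size. Qed.

Lemma first_max_le_last d : 0 < size d -> first_max d <= last_max d.
Proof.
move=> d0; rewrite /first_max /last_max -mem_drop_last_gap.
by rewrite drop_index ?mem_head // maxs_mem.
Qed.

Lemma maxs_split g d : maxs d = maxn (maxs (take g d)) (maxs (drop g d)).
Proof. by rewrite -maxs_cat cat_take_drop. Qed.

Lemma maxs_take g d : maxs d \notin drop g d -> maxs (take g d) = maxs d.
Proof.
case: (posnP (size d)) => [/size0nil -> //|d0 nd].
have := maxs_mem d0; rewrite -[X in _ \in X](cat_take_drop g d) mem_cat.
by rewrite (negbTE nd) orbF => /leq_maxs; have := maxs_split g d; lia.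
Qed.

Lemma maxs_drop g d : maxs d \in drop g d -> maxs (drop g d) = maxs d.
Proof. by move/leq_maxs; have := maxs_split g d; lia. Qed.

Lemma maxs_drop_lt g d : 0 < maxs d -> maxs d \notin drop g d ->
  maxs (drop g d) < maxs d.
Proof.
move=> d0 nd; have le : maxs (drop g d) <= maxs d.
  by rewrite (maxs_split g d) leq_maxr.
rewrite ltn_neqAle le andbT; apply: contra nd => /eqP e.
rewrite -{1}e maxs_mem //; case: (drop g d) e d0 => //.
by rewrite maxs_nil => <-.
Qed.

Lemma maxs_insert_profile g d : 0 < maxs d ->
  maxs (insert_profile g d) = maxs d + (g < last_max d).
Proof.
move=> d0; rewrite /last_max -mem_drop_last_gap /insert_profile.
rewrite maxs_cat maxs_cons maxs_raise_records.
have := maxs_split g d.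
case: (boolP (_ \in _)) => [/maxs_drop ->|nd]; first by lia.
by have := maxs_drop_lt d0 nd; rewrite (maxs_take nd); lia.
Qed.

(** An insertion left of the first maximum shifts it by one.  One at gap [g]
between the first and the last maximum makes the next maximum after [g] the
only one; with the new entry, at least [g + 2] gaps are on its left. *)
Lemma first_max_insert_profile g d (l := first_max d) (r := last_max d) :
    0 < maxs d -> g <= size d ->
  l + (g < l) + (if l <= g < r then g - l + 2 else 0)
    <= first_max (insert_profile g d).
Proof.
move=> d0 gd; rewrite {1}/first_max maxs_insert_profile // /r /last_max.
have sg : size (take g d) = g by rewrite size_takel.
have sz : 0 < size d by case: (d) d0 => //; rewrite maxs_nil.
rewrite -mem_drop_last_gap.
case: (boolP (_ \in _)) => [di|nd].
  have M := maxs_drop di.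
  have ix : index (maxs d).+1 (insert_profile g d) =
      g + (index (maxs d) (drop g d)).+1.
    rewrite /insert_profile index_cat ifF; last first.
      apply/negP => /mem_take /leq_maxs; lia.
    rewrite sg /= ifF; last by lia.
    by rewrite -M index_raise_records // M.
  rewrite addn1 ix; case: ltnP => gl /=; last by lia.
  suff e : index (maxs d) d = g + index (maxs d) (drop g d).
    rewrite /l /first_max e; lia.
  rewrite -{2}[d](cat_take_drop g) index_cat sg ifF //.
  apply/negP => /index_ltn; rewrite -/l.
  by move: gl; rewrite /l /first_max; lia.
have T := maxs_take nd.
have mt : maxs d \in take g d.
  by have := maxs_mem sz; rewrite -{2}[d](cat_take_drop g) mem_cat (negbTE nd) orbF.
have il := index_ltn mt.
rewrite addn0 /insert_profile index_cat mt.
have -> : index (maxs d) (take g d) = index (maxs d) d.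
  by rewrite -{4}[d](cat_take_drop g) index_cat mt.
by rewrite andbF addn0 /l /first_max; lia.
Qed.

(** The gaps [l <= g < r] contribute 2 + 3 + ... + (r - l + 1). *)
Lemma sum_gap_bonus n l r : l <= r <= n ->
  l.*2 + (r - l) ^ 2 <=
    (\sum_(0 <= g < n) ((g < l) + (if l <= g < r then g - l + 2 else 0))).*2.
Proof.
suff H k : (minn l k).*2 + (minn r k - l) ^ 2 <=
    (\sum_(0 <= g < k) ((g < l) + (if l <= g < r then g - l + 2 else 0))).*2.
  move=> /andP[lr rn]; have := H n.
  by rewrite (minn_idPl rn) (minn_idPl (leq_trans lr rn)).
elim: k => [|k IHk]; first by rewrite big_geq // !minn0.
rewrite big_nat_recr //= doubleD; move: IHk; set S := \sum_(_ <= _ < _) _.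
case: (boolP (k < r)) => [kr|]; last first.
  rewrite -leqNgt => kr; rewrite andbF addn0 (minn_idPl kr) (minn_idPl (leqW kr)).
  by lia.
rewrite andbT (minn_idPr (ltnW kr)) (minn_idPr kr).
case: (boolP (l <= k)) => [lk|]; last by rewrite -ltnNge => lk; nia.
by rewrite (minn_idPl lk) (minn_idPl (leqW lk)); nia.
Qed.

(** Without the square this says that [first_max] divided by the number of gaps
is a submartingale; the square measures its drift. *)
Lemma sum_first_max_insert d (l := first_max d) (r := last_max d) (n := size d) :
    0 < maxs d ->
  (n.+2 * l).*2 + (r - l) ^ 2 <=
    (\sum_(0 <= g < n.+1) first_max (insert_profile g d)).*2.
Proof.
move=> d0; have n0 : 0 < size d by case: (d) d0 => //; rewrite maxs_nil.
have lrn : l <= r <= n.+1.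
  by rewrite first_max_le_last // (leq_trans (last_max_size d)).
apply: (@leq_trans (\sum_(0 <= g < n.+1)
    (l + ((g < l) + (if l <= g < r then g - l + 2 else 0)))).*2); last first.
  rewrite leq_double big_nat [leqRHS]big_nat; apply: leq_sum => g /andP[_ gn].
  by rewrite addnA first_max_insert_profile.
rewrite big_split /= sum_nat_const_nat subn0 doubleD mulSn doubleD -addnA addnCA.
by rewrite leq_add2l sum_gap_bonus.
Qed.

Lemma sum_ltn m n : \sum_(0 <= i < n) (i < m) = minn m n.
Proof.
elim: n => [|n IHn]; first by rewrite big_geq // minn0.
by rewrite big_nat_recr //= IHn; lia.
Qed.

Lemma sum_maxs_insert d (n := size d) : 0 < maxs d ->
  \sum_(0 <= g < n.+1) maxs (insert_profile g d) = n.+1 * maxs d + last_max d.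
Proof.
move=> d0; under eq_bigr => g _ do rewrite maxs_insert_profile //.
rewrite big_split /= sum_nat_const_nat subn0; congr (_ + _).
rewrite sum_ltn; apply/minn_idPl.
by rewrite (leq_trans (last_max_size d)).
Qed.

Lemma maxs_insert_bounds g d : maxs d <= maxs (insert_profile g d) <= (maxs d).+1.
Proof.
case: (posnP (maxs d)) => [d0|/maxs_insert_profile ->]; last by case: (_ < _); lia.
rewrite d0 /insert_profile maxs_cat maxs_cons maxs_raise_records.
by have := maxs_split g d; lia.
Qed.

Lemma maxs_profile_gt0 n c : c \in codes n.+1 -> 0 < maxs (profile c).
Proof.
case/codes_consP => g [c' [-> _ _]].
by rewrite /= /insert_profile maxs_cat maxs_cons; lia.
Qed.

Lemma take_raise_records k m d :
  take k (raise_records m d) = raise_records m (take k d).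
Proof. by elim: d m k => [|x d IHd] m [|k] //=; rewrite IHd. Qed.

Lemma take_insert_profile_le j g d : j <= g -> g <= size d ->
  take j (insert_profile g d) = take j d.
Proof.
move=> jg gd; rewrite /insert_profile take_cat size_takel //.
case: ltngtP jg => // [jg _|-> _]; first by rewrite take_takel // ltnW.
by rewrite subnn take0 cats0.
Qed.

Lemma take_insert_profile_gt j g d : g <= j -> j <= size d ->
  take j.+1 (insert_profile g d) = insert_profile g (take j d).
Proof.
move=> gj jd; rewrite /insert_profile take_cat size_takel ?(leq_trans gj) //.
rewrite ltnNge leqW //= subSn //= take_raise_records take_takel //.
by rewrite take_drop subnK.
Qed.

(** * Means over insertion codes *)

Local Open Scope ring_scope.
Import Order.TTheory GRing.Theory Num.Theory.

Section Mean.
Variable R : realFieldType.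
Implicit Types (F G : seq nat -> R) (n : nat).

Definition mean n F : R := (\sum_(c <- codes n) F c) / n`!%:R.

Lemma fact_neq0 n : n`!%:R != 0 :> R.
Proof. by rewrite pnatr_eq0 -lt0n fact_gt0. Qed.

Lemma mean_succ n F :
  mean n.+1 F = mean n (fun c => (\sum_(0 <= g < n.+1) F (g :: c)) / n.+1%:R).
Proof.
rewrite /mean codesS big_allpairs_dep -mulr_suml factS natrM invfM mulrA.
by congr (_ * _ * _); apply: eq_bigr.
Qed.

Lemma eq_mean n F G : {in codes n, F =1 G} -> mean n F = mean n G.
Proof. by move=> FG; congr (_ / _); apply: eq_big_seq => c /FG. Qed.

Lemma le_mean n F G : {in codes n, forall c, F c <= G c} -> mean n F <= mean n G.
Proof.
move=> FG; rewrite ler_pM2r ?invr_gt0 ?ltr0n ?fact_gt0 //.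
by rewrite big_seq [leRHS]big_seq; exact: ler_sum.
Qed.

Lemma meanD n F G : mean n (fun c => F c + G c) = mean n F + mean n G.
Proof. by rewrite /mean big_split mulrDl. Qed.

Lemma meanZ n a F : mean n (fun c => a * F c) = a * mean n F.
Proof. by rewrite /mean -mulr_sumr mulrA. Qed.

Lemma mean_cst n a : mean n (fun=> a) = a.
Proof.
rewrite /mean big_const_seq count_predT size_codes iter_addr_0.
by rewrite -[a *+ _]mulr_natr mulfK ?fact_neq0.
Qed.

Lemma mean_sum n (I : Type) (s : seq I) (H : I -> seq nat -> R) :
  mean n (fun c => \sum_(i <- s) H i c) = \sum_(i <- s) mean n (H i).
Proof. by rewrite /mean exchange_big mulr_suml. Qed.

Lemma sqr_mean_le n F : mean n F ^+ 2 <= mean n (fun c => F c ^+ 2).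
Proof.
set m := mean n F.
have : 0 <= mean n (fun c => (F c - m) ^+ 2).
  by rewrite -(mean_cst n 0); apply: le_mean => c _; exact: sqr_ge0.
rewrite (_ : mean _ _ = mean n (fun c => F c ^+ 2) - m ^+ 2) ?subr_ge0 //.
rewrite (_ : mean n _ =
  mean n (fun c => F c ^+ 2 + ((- 2 * m) * F c + m ^+ 2))); last first.
  by apply: eq_mean => c _; ring.
by rewrite !meanD meanZ mean_cst -/m; ring.
Qed.

(** An insertion affects the profile only at and to the right of its gap, so the
first [j] entries evolve on their own, by the insertions at the first [j] gaps,
each of them equally likely. *)
Lemma mean_prefix j n (F : seq nat -> R) : (j <= n)%N ->
  mean n (fun c => F (take j (profile c))) = mean j (fun c => F (profile c)).
Proof.
elim: n j F => [|n IHn] j F.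
  by rewrite leqn0 => /eqP ->; rewrite /mean /= !big_seq1.
rewrite leq_eqVlt => /predU1P[->|].
  by apply: eq_mean => c cn; rewrite take_oversize // size_profile (size_code cn).
rewrite ltnS; case: j => [_|j jn].
  rewrite (eq_mean (G := fun=> F [::])) ?mean_cst => [|c _]; last by rewrite take0.
  by rewrite /mean big_seq1 fact0 divr1.
pose F1 d := \sum_(0 <= g < j.+1) F (insert_profile g d).
rewrite mean_succ (eq_mean (G := fun c => n.+1%:R^-1 * F1 (take j (profile c)) +
    (n - j)%:R / n.+1%:R * F (take j.+1 (profile c)))); last first.
  move=> c cn; have sc : size (profile c) = n by rewrite size_profile (size_code cn).
  rewrite (big_cat_nat (n := j.+1)) //=; last by rewrite ltnS ltnW.
  rewrite mulrDl mulrC; congr (_ * _ + _).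
    rewrite /F1 big_nat [RHS]big_nat; apply: eq_bigr => g /andP[_ gj].
    by rewrite take_insert_profile_gt ?sc ?(ltnW jn) // -ltnS.
  rewrite big_nat (eq_bigr (fun=> F (take j.+1 (profile c)))); last first.
    by move=> g /andP[jg gn]; rewrite take_insert_profile_le ?sc // -ltnS.
  rewrite -big_nat sumr_const_nat subSS -mulr_natr; ring.
rewrite meanD !meanZ (IHn j) ?(ltnW jn) // (IHn j.+1) //.
have -> : mean j.+1 (fun c => F (profile c)) =
    j.+1%:R^-1 * mean j (fun c => F1 (profile c)).
  by rewrite mean_succ -meanZ; apply: eq_mean => c _; rewrite mulrC.
rewrite natrB ?(ltnW jn) //; set x := mean _ _; field.
by rewrite !nat1r !pnatr_eq0.
Qed.

Definition mean_max n : R := mean n (fun c => (maxs (profile c))%:R).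
Definition mean_depth n : R := mean n (fun c => (code_depth c)%:R).

Lemma code_depth_le_max c : (code_depth c <= maxs (profile c))%N.
Proof.
elim: c => //= g c IHc; have := maxs_split g (profile c).
by have := maxs_insert_bounds g (profile c); lia.
Qed.

Lemma mean_depth_le n : mean_depth n <= mean_max n.
Proof. by apply: le_mean => c _; rewrite ler_nat code_depth_le_max. Qed.

Lemma mean_max_succ n : mean_max n.+1 <= mean_max n + 1.
Proof.
rewrite /mean_max mean_succ -[X in _ + X](mean_cst n) -meanD; apply: le_mean => c cn.
rewrite ler_pdivrMr ?ltr0n //.
rewrite mulr_natr -[X in _ *+ X](subn0 n.+1) -sumr_const_nat.
apply: ler_sum => g _; rewrite natr1 ler_nat.
by have /andP[] := maxs_insert_bounds g (profile c).
Qed.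

Lemma mean_max_diff n b : (b <= n)%N -> mean_max n - b%:R <= mean_max (n - b).
Proof.
elim: b => [|b IHb] bn; first by rewrite subr0 subn0.
have := IHb (ltnW bn); rewrite -subSS subSn //.
have := mean_max_succ (n - b.+1); rewrite -natr1; lra.
Qed.

(** * Comparison of the depth with the maximum of the profile *)

(** Among the letters present before the last [r] insertions, the number of those
to the right of all letters inserted since; at the insertion at gap [g] of a
word of size [size c'], at most [size c' - g] of them are to its right. *)
Fixpoint tail_gap (r : nat) (c : seq nat) : nat :=
  if r is r'.+1 then
    if c is g :: c' then minn (tail_gap r' c') (size c' - g) else 0
  else size c.

(** Profile entries only grow, and an entry to the right of all recent letters
keeps its distance to the right end.  So the insertion of the
rightmost recent letter had on its left at least the maximum of the prefix of
the old profile which that letter delimits.  The third claim makes the induction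
work. *)
Lemma tail_gapP r N c : c \in codes (N + r) ->
  [/\ (tail_gap r c <= N)%N,
      (maxs (take (N - tail_gap r c) (profile (drop r c))) <= code_depth c)%N
    & forall y, (y <= tail_gap r c ->
      maxs (take (N - y) (profile (drop r c))) <=
        maxs (take (size c - y) (profile c)))%N].
Proof.
elim: r c => [|r IHr] c.
  rewrite addn0 => /size_code cN; rewrite /= cN leqnn subnn take0 drop0.
  by split=> //; rewrite maxs_nil.
rewrite addnS => /codes_consP[g [c' [-> c'N gN]]].
have [bN dN mN] := IHr c' c'N; have sc := size_code c'N.
split=> /=; first by rewrite geq_min bN.
  case: (leqP (tail_gap r c') (size c' - g)) => h; first by rewrite leq_max dN.
  rewrite leq_max; apply/orP; right; apply: leq_trans (mN _ (ltnW h)) _.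
  by rewrite subKn // sc.
move=> y; rewrite leq_min => /andP[yb yg]; apply: leq_trans (mN y yb) _.
have yN : (y <= size c')%N by rewrite (leq_trans yg) ?leq_subr.
rewrite subSn // take_insert_profile_gt ?size_profile ?leq_subr //; last first.
  by rewrite leq_subRL // addnC -leq_subRL ?sc // -sc.
by have /andP[] := maxs_insert_bounds g (take (size c' - y) (profile c')).
Qed.

(** The most recent gaps are independent of the older ones. *)
Lemma mean_tail_gap_indep N r (H : nat -> seq nat -> R) :
  mean (N + r) (fun c => H (tail_gap r c) (drop r c)) =
    mean (N + r) (fun c => mean N (H (tail_gap r c))).
Proof.
elim: r H => [|r IHr] H.
  rewrite addn0 (eq_mean (G := H N)) => [|c /size_code cN]; last by rewrite /= cN drop0.
  by rewrite -[LHS](mean_cst N); apply: eq_mean => c /size_code cN; rewrite /= cN.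
pose H' b e := (\sum_(0 <= g < (N + r).+1) H (minn b (N + r - g)) e) / (N + r).+1%:R.
rewrite addnS !mean_succ.
(* [H'] averages over the most recent gap, so the induction applies to it. *)
transitivity (mean (N + r) (fun c => H' (tail_gap r c) (drop r c))).
  by apply: eq_mean => c /size_code cN; rewrite /= cN.
rewrite IHr; apply: eq_mean => c /size_code cN; rewrite /H'.
rewrite (eq_mean (G := fun e => (N + r).+1%:R^-1 *
  (\sum_(0 <= g < (N + r).+1) H (minn (tail_gap r c) (N + r - g)) e))); last first.
  by move=> e _; rewrite mulrC.
by rewrite meanZ mean_sum mulrC /= cN.
Qed.

(** With [k] late insertions done, [i + k + 1] of the [N + k + 1] gaps leave
[N - i] old letters on their right; the product of these ratios telescopes. *)
Lemma mean_tail_gap_gt N r i : (i < N)%N ->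
  mean (N + r) (fun c => (N - i <= tail_gap r c)%N%:R) * 'C(N + r, r)%:R =
    'C(i + r, r)%:R.
Proof.
move=> iN; elim: r => [|r IHr].
  rewrite !addn0 !bin0 mulr1 -[RHS](mean_cst N); apply: eq_mean => c /size_code cN.
  by rewrite /= cN leq_subr.
rewrite !addnS mean_succ.
rewrite (eq_mean (G := fun c => (i + r).+1%:R / (N + r).+1%:R *
  (N - i <= tail_gap r c)%N%:R)); last first.
  move=> c /size_code cN; rewrite mulrAC; congr (_ / _).
  rewrite -natr_sum -natrM; congr _%:R; rewrite /= cN.
  case: (leqP (N - i) (tail_gap r c)) => h; last first.
    by rewrite muln0 big1 // => g _; rewrite leq_min leqNgt h.
  rewrite muln1 -[RHS](minn_idPl (_ : _ <= (N + r).+1)%N); last by lia.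
  rewrite -sum_ltn big_nat [RHS]big_nat; apply: eq_bigr => g /andP[_ gN].
  by rewrite leq_min h; lia.
have e n : n.+1%:R * 'C(n, r)%:R = r.+1%:R * 'C(n.+1, r.+1)%:R :> R.
  by rewrite -!natrM mul_bin_diag.
have r0 : r.+1%:R != 0 :> R by rewrite pnatr_eq0.
have n0 : (N + r).+1%:R != 0 :> R by rewrite pnatr_eq0.
apply: (mulfI r0); rewrite -e -IHr meanZ mulrCA -e mulrA.
by field; rewrite -natrD nat1r pnatr_eq0.
Qed.

Lemma sum_bin_diag N r : (\sum_(0 <= i < N) 'C(i + r, r) = 'C(N + r, r.+1))%N.
Proof.
elim: N => [|N IHN]; first by rewrite big_geq // bin_small.
by rewrite big_nat_recr //= IHN addSn binS.
Qed.

Lemma mean_tail_gap N r : mean (N + r) (fun c => (tail_gap r c)%:R) = N%:R / r.+1%:R.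
Proof.
rewrite (eq_mean (G := fun c => \sum_(0 <= i < N) (N - i <= tail_gap r c)%N%:R)).
  rewrite mean_sum.
  have b0 : 'C(N + r, r)%:R != 0 :> R by rewrite pnatr_eq0 -lt0n bin_gt0 leq_addl.
  apply: (mulIf b0); rewrite mulr_suml big_nat.
  rewrite (eq_bigr (fun i => 'C(i + r, r)%:R)) => [|i /andP[_ iN]]; last first.
    exact: mean_tail_gap_gt.
  rewrite -big_nat -natr_sum sum_bin_diag.
  have r0 : r.+1%:R != 0 :> R by rewrite pnatr_eq0.
  apply: (mulIf r0); rewrite mulrAC divfK // -!natrM.
  by rewrite mulnC mul_bin_left addnK.
move=> c cN; have [bN _ _] := tail_gapP cN; rewrite -natr_sum; congr _%:R.
move: (tail_gap r c) bN => b bN.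
rewrite big_nat_rev /= -[LHS](minn_idPl bN) -sum_ltn big_nat [RHS]big_nat.
by apply: eq_bigr => i /andP[_ iN]; rewrite add0n subKn.
Qed.

(** The maximum over the prefix has mean [mean_max (N - b)] once [b] is fixed, by
independence and [mean_prefix]; each letter adds at most 1 to [mean_max], and
the mean of [b] is [N / (r + 1)]. *)
Lemma mean_depth_ge N r : mean_max N - N%:R / r.+1%:R <= mean_depth (N + r).
Proof.
pose H b e : R := (maxs (take (N - b) (profile e)))%:R.
apply: (@le_trans _ _ (mean (N + r) (fun c => H (tail_gap r c) (drop r c)))); last first.
  by apply: le_mean => c cN; rewrite ler_nat; have [] := tail_gapP cN.
rewrite mean_tail_gap_indep -mean_tail_gap -(mean_cst (N + r) (mean_max N)).
rewrite -[X in _ - X]mul1r -mulNr -meanZ -meanD; apply: le_mean => c cN.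
have [bN _ _] := tail_gapP cN.
rewrite mulN1r; apply: le_trans (mean_max_diff bN) _.
by rewrite /mean_max -(mean_prefix (fun d => (maxs d)%:R) (leq_subr _ N)).
Qed.
End Mean.

(** * Convergence *)

Section Leader.
Variable R : realFieldType.

Definition mean_first n : R :=
  mean n (fun c => (first_max (profile c))%:R / n.+1%:R).

Definition mean_last n : R :=
  mean n (fun c => (last_max (profile c))%:R / n.+1%:R).

Lemma mean_max_increment n : mean_max R n.+2 - mean_max R n.+1 = mean_last n.+1.
Proof.
rewrite {1}/mean_max mean_succ (eq_mean (G := fun c => (maxs (profile c))%:R +
    (last_max (profile c))%:R / n.+2%:R)); last first.
  move=> c cn; rewrite -natr_sum /=.
  have := sum_maxs_insert (maxs_profile_gt0 cn).
  rewrite size_profile (size_code cn) => ->.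
  by rewrite natrD natrM mulrDl mulrAC mulfV ?mul1r // pnatr_eq0.
by rewrite meanD addrAC subrr add0r.
Qed.

(** Divide [sum_first_max_insert] by the numbers of gaps before and after the
insertion and apply the Cauchy-Schwarz inequality in the form [sqr_mean_le].
The constant is 4 rather than 2 to absorb the ratio of these two numbers. *)
Lemma mean_first_succ n :
  mean_first n.+1 + (mean_last n.+1 - mean_first n.+1) ^+ 2 / 4 <= mean_first n.+2.
Proof.
have -> : mean_last n.+1 - mean_first n.+1 = mean n.+1 (fun c =>
    (last_max (profile c) - first_max (profile c))%N%:R / n.+2%:R).
  rewrite -[- _]mulN1r -meanZ -meanD; apply: eq_mean => c cn.
  rewrite natrB; first by rewrite mulN1r -mulrBl.
  by apply: first_max_le_last; rewrite size_profile (size_code cn).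
have := sqr_mean_le n.+1 (fun c =>
    (last_max (profile c) - first_max (profile c))%N%:R / n.+2%:R : R).
set q := mean _ _ ^+ 2; set s := mean _ _ => qs.
apply: (@le_trans _ _ (mean_first n.+1 + 4^-1 * s)); first by lra.
rewrite -meanZ -meanD [leRHS]mean_succ; apply: le_mean => c cn.
have := sum_first_max_insert (maxs_profile_gt0 cn).
rewrite size_profile (size_code cn) -mulr_suml -natr_sum /=.
set l := first_max _; set r := last_max _; set S := (\sum_(_ <= _ < _) _)%N.
move=> H; have {H} : ((n.+3 * l).*2 + (r - l) ^ 2)%:R <= S.*2%:R :> R.
  by rewrite ler_nat.
rewrite natrD natrX -!muln2 !natrM; set k := (r - l)%N%:R.
have k0 : 0 <= k ^+ 2 := sqr_ge0 k.
have n0 : 0 <= n%:R :> R by [].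
have -> : n.+3%:R = n%:R + 3 :> R by rewrite -natrD addn3.
have -> : n.+2%:R = n%:R + 2 :> R by rewrite -natrD addn2.
set a := n%:R in n0 *; set L := l%:R; set T := S%:R => H.
have a2 : 0 < a + 2 by lra.
have a3 : 0 < a + 3 by lra.
rewrite ler_pdivlMr // ler_pdivlMr //.
have -> : (L / (a + 2) + 4^-1 * (k / (a + 2)) ^+ 2) * (a + 2) * (a + 3) =
    (a + 3) * L + k ^+ 2 * ((a + 3) / (4 * (a + 2))).
  by field; rewrite lt0r_neq0.
have : (a + 3) / (4 * (a + 2)) <= 2^-1 by rewrite ler_pdivrMr ?mulr_gt0 //; lra.
move=> /(ler_wpM2l k0); lra.
Qed.

Lemma mean_first_le_last n : mean_first n.+1 <= mean_last n.+1.
Proof.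
apply: le_mean => c cn; rewrite ler_pM2r ?invr_gt0 ?ltr0n // ler_nat.
by apply: first_max_le_last; rewrite size_profile (size_code cn).
Qed.

Lemma mean_last_le1 n : mean_last n <= 1.
Proof.
rewrite -(mean_cst n 1); apply: le_mean => c cn.
rewrite ler_pdivrMr ?ltr0n // mul1r ler_nat (leq_trans (last_max_size _)) //.
by rewrite size_profile (size_code cn).
Qed.
End Leader.

Section Limits.
Variable R : realType.
Local Open Scope classical_set_scope.

Lemma mean_last_cvg : exists l : R, mean_last R n @[n --> \oo] --> l.
Proof.
pose f n := mean_first R n.+1; pose g n := mean_last R n.+1.
have fS n : f n + (g n - f n) ^+ 2 / 4 <= f n.+1 := mean_first_succ R n.
have fg n : f n <= g n := mean_first_le_last R n.
have f_nd : nondecreasing_seq f.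
  apply/nondecreasing_seqP => n; apply: le_trans (fS n).
  by rewrite lerDl mulr_ge0 ?sqr_ge0.
have f_cvg : cvgn f.
  apply: nondecreasing_is_cvgn => //; exists 1 => _ [n _ <-].
  exact: le_trans (fg n) (mean_last_le1 R _).
exists (limn f); rewrite -cvg_shiftS -/g.
have incr0 : f n.+1 - f n @[n --> \oo] --> (0 : R).
  rewrite -(subrr (limn f)); apply: cvgB => //.
  by rewrite (cvg_shiftS f).
have gap0 : g n - f n @[n --> \oo] --> (0 : R).
  apply/cvgr0Pnorm_lt => e e0.
  have /cvgr0Pnorm_lt /(_ (e ^+ 2 / 4)) := incr0.
  rewrite divr_gt0 ?exprn_gt0 // => /(_ isT); apply: filterS => n /=.
  rewrite ger0_norm ?subr_ge0 ?f_nd // ger0_norm ?subr_ge0 // => h.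
  rewrite -(ltr_pXn2r (n := 2)) ?nnegrE ?subr_ge0 ?(ltW e0) //.
  by have := fS n; lra.
rewrite -[limn f]add0r; have -> : g = (fun n => g n - f n) \+ f.
  by apply/funext => n /=; rewrite subrK.
exact: cvgD.
Qed.

Lemma mean_max_cvg : exists l : R, mean_max R n / n%:R @[n --> \oo] --> l.
Proof.
have [l ll] := mean_last_cvg; exists l.
pose a n := mean_max R n.+1 - mean_max R n.
have al : a @ \oo --> l.
  rewrite -cvg_shiftS (eq_cvg _ _ (mean_max_increment R)).
  by rewrite (cvg_shiftS (mean_last R)).
rewrite -(cvg_shiftS (fun n => mean_max R n / n%:R)).
rewrite (@eq_cvg _ _ _ _ (arithmetic_mean a)); first exact: cesaro.
move=> n; symmetry.
rewrite /arithmetic_mean /= mulrC; congr (_ / _).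
rewrite seriesEnat /= telescope_sumr // [mean_max R 0](_ : _ = 0) ?subr0 //.
by rewrite /mean_max /mean /= big_seq1 maxs_nil mul0r.
Qed.

(** By [mean_depth_ge] the gap is at most [m + n / (m + 1)] for every [m <= n]. *)
Lemma mean_depth_gap_cvg :
  (mean_max R n - mean_depth R n) / n%:R @[n --> \oo] --> (0 : R).
Proof.
apply/cvgr0Pnorm_lt => e e0.
have [m me] : exists m : nat, m.+1%:R^-1 < e / 2 :> R.
  have /cvgr0Pnorm_lt /(_ _ (divr_gt0 e0 (ltr0n R 2))) := @cvg_harmonic R.
  by case=> m _ /(_ m (leqnn m)) /=; rewrite ger0_norm //; exists m.
have [k ke] : exists k : nat, m%:R / k.+1%:R < e / 2 :> R.
  have : m%:R * @harmonic R n @[n --> \oo] --> (0 : R).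
    by rewrite -(mulr0 m%:R); apply: cvgMr; exact: cvg_harmonic.
  move=> /cvgr0Pnorm_lt /(_ _ (divr_gt0 e0 (ltr0n R 2))).
  by case=> k _ /(_ k (leqnn k)) /=; rewrite ger0_norm //; exists k.
exists (maxn m k.+1) => // n /=; rewrite geq_max => /andP[mn kn].
have n0 : 0 < n%:R :> R by rewrite ltr0n (leq_trans _ kn).
rewrite ger0_norm; last by rewrite divr_ge0 ?subr_ge0 ?mean_depth_le.
have := mean_depth_ge R (n - m) m; rewrite subnK // => h1.
have := mean_max_diff R mn => h2.
have h3 : (n - m)%:R / m.+1%:R <= n%:R / m.+1%:R :> R.
  by rewrite ler_pM2r ?invr_gt0 ?ltr0n // ler_nat leq_subr.
have h4 : m%:R / n%:R < e / 2 :> R.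
  apply: le_lt_trans ke; apply: ler_wpM2l => //.
  by rewrite lef_pV2 ?posrE ?ltr0n ?ler_nat // (leq_trans _ kn).
have h5 : n%:R / m.+1%:R / n%:R = m.+1%:R^-1 :> R.
  by rewrite mulrAC divff ?mul1r // lt0r_neq0.
move: h1 h3 h5; set y := _ / _; set z := _ / _ => h1 h3 h5.
apply: (@le_lt_trans _ _ ((m%:R + z) / n%:R)).
  by rewrite ler_pM2r ?invr_gt0 //; lra.
by rewrite mulrDl h5 [e]splitr ltrD.
Qed.

Lemma average_depthE n : average_depth R n = mean_depth R n.
Proof.
rewrite /average_depth /mean_depth /mean; congr (_ / _).
transitivity (\sum_(w <- [seq one_line p | p : 'S_n]) (stack_sorting_depth w)%:R : R).
  by rewrite big_map big_enum.
rewrite (perm_big _ (perm_one_line_word n)) big_map /=.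
by apply: eq_big_seq => c cn; rewrite (depth_word (leqnn n) cn).
Qed.
End Limits.

Unset Implicit Arguments.
Local Open Scope classical_set_scope.
Local Open Scope ring_scope.

Theorem theorem1p3 (R : realType) :
  exists l : R, average_depth R n / n%:R @[n --> \oo] --> l.
Proof.
have [l ll] := mean_max_cvg R; exists l.
rewrite (@eq_cvg _ _ _ _ ((fun n => mean_max R n / n%:R) \-
  (fun n => (mean_max R n - mean_depth R n) / n%:R))).
  by rewrite -[l]subr0; apply: cvgB ll _; exact: mean_depth_gap_cvg.
by move=> n /=; rewrite average_depthE -mulrBl opprB addrC subrK.
Qed.
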